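(* Consider the abstract setting of meshes, refinement, discrete solutions $u_H\in\mathcal X_H$ and refinement indicators $\eta_H(T)$ described in the context, with initial mesh $\mathcal T_0$ and set of admissible meshes $\mathbb T=\mathbb T(\mathcal T_0)$. Suppose that there are functions $S,R:\mathbb R_{\ge0}\to\mathbb R_{\ge0}$ which are continuous at $0$ with $S(0)=0=R(0)$, and a constant $0<q_{\rm red}<1$, such that for all $\mathcal T_H\in\mathbb T$ and all $\mathcal T_h\in\mathbb T(\mathcal T_H)$ there hold (stability on non-refined elements) $\ \eta_h(\mathcal T_h\cap\mathcal T_H)\le \eta_H(\mathcal T_h\cap\mathcal T_H)+S(\|u_h-u_H\|_{\mathcal X})$; (reduction on refined elements) $\ \eta_h(\mathcal T_h\setminus\mathcal T_H)^2\le q_{\rm red}\,\eta_H(\mathcal T_H\setminus\mathcal T_h)^2+R(\|u_h-u_H\|_{\mathcal X})$. Let $0<\theta\le1$ be fixed. Let $(\mathcal T_\ell)_{\ell\in\mathbb N_0}$, $(u_\ell)_{\ell\in\mathbb N_0}$, $(\eta_\ell)_{\ell\in\mathbb N_0}$ be the output of the adaptive algorithm, where the sets of marked elements $\mathcal M_\ell\subseteq\mathcal T_\ell$ satisfy the Dörfler criterion $$\theta\,\eta_\ell^2\le\eta_\ell(\mathcal M_\ell)^2\quad\text{for all }\ell\in\mathbb N_0 .$$ If there exists $u_\infty\in\mathcal X$ such that $\|u_\infty-u_\ell\|_{\mathcal X}\to0$ as $\ell\to\infty$, then $$\eta_\ell\to0\quad\text{as }\ell\to\infty .$$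
   Context: Meshes: Let $\Omega\subset\mathbb R^d$ be a bounded domain (or a manifold in $\mathbb R^d$) with positive measure $|\Omega|>0$. A mesh $\mathcal T_H$ of $\Omega$ is a finite set of compact sets $T$ with $|T|>0$, such that $|T\cap T'|=0$ for all $T\ne T'$ in $\mathcal T_H$, and $\overline\Omega=\bigcup_{T\in\mathcal T_H}T$. Refinement: $\mathrm{refine}(\cdot)$ is a fixed refinement strategy: for each mesh $\mathcal T_H$ and each $\mathcal M_H\subseteq\mathcal T_H$ it returns a mesh $\mathcal T_h=\mathrm{refine}(\mathcal T_H,\mathcal M_H)$ such that at least the marked elements are refined, i.e., $\mathcal M_H\subseteq\mathcal T_H\setminus\mathcal T_h$. (It is not required that elements of $\mathcal T_H$ are unions of elements of $\mathcal T_h$.) For a mesh $\mathcal T_H$, $\mathbb T(\mathcal T_H)$ is the set of all meshes obtained from $\mathcal T_H$ by finitely many (possibly zero) successive applications of $\mathrm{refine}$ with arbitrary sets of marked elements. $\mathcal T_0$ is a fixed initial mesh and $\mathbb T:=\mathbb T(\mathcal T_0)$. Discrete setting: $\mathcal X$ is a normed space. To each mesh $\mathcal T_H$ there are associated a subspace $\mathcal X_H\subseteq\mathcal X$, an element $u_H\in\mathcal X_H$ (the discrete solution), and numbers $\eta_H(T)\ge0$ for all $T\in\mathcal T_H$ (refinement indicators). No further relation between these objects is assumed. For $\mathcal U_H\subseteq\mathcal T_H$ write $\eta_H(\mathcal U_H):=\big(\sum_{T\in\mathcal U_H}\eta_H(T)^2\big)^{1/2}$, and $\eta_H:=\eta_H(\mathcal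 T_H)$. Quantities associated with $\mathcal T_h$ resp. $\mathcal T_\ell$ carry the index $h$ resp. $\ell$. Adaptive algorithm: Starting from $\mathcal T_0$, for each $\ell=0,1,2,\dots$: compute $u_\ell\in\mathcal X_\ell$; compute $\eta_\ell(T)$ for all $T\in\mathcal T_\ell$; determine a set $\mathcal M_\ell\subseteq\mathcal T_\ell$ of marked elements; set $\mathcal T_{\ell+1}:=\mathrm{refine}(\mathcal T_\ell,\mathcal M_\ell)$. *)

(* Defs.v *)
(* MathComp-Analysis; the scalars form an arbitrary R : realType, and R^d is
   'rV[R]_d with its product topology. *)
From HB Require Import structures.
From mathcomp Require Export all_boot all_order all_algebra.
From mathcomp Require Export finmap.
From mathcomp Require Export all_classical all_reals all_analysis.

Set Implicit Arguments.
Unset Strict Implicit.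
Unset Printing Implicit Defensive.

Export Order.TTheory GRing.Theory Num.Theory.
Export numFieldNormedType.Exports.

Open Scope classical_set_scope.
Open Scope ring_scope.

Section Measures.
Variables (R : realType) (d : nat).
Local Notation E := 'rV[R]_d.
Local Open Scope ereal_scope.

Definition box (a b : E) : set E :=
  [set x | forall i, (a ord0 i <= x ord0 i <= b ord0 i)%R].

Definition box_volume (a b : E) : R :=
  (\prod_(i < d) Num.max 0 (b ord0 i - a ord0 i))%R.

(* d-dimensional Lebesgue (outer) measure, the library having only the
   one-dimensional one. It is only evaluated at open sets, compact sets, and
   intersections of compact sets, which are all Lebesgue measurable. *)
Definition lebesgue_outer (A : set E) : \bar R :=
  ereal_inf [set s | exists a b : nat -> E,
    A `<=` \bigcup_k box (a k) (b k) /\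
    s = \sum_(0 <= k <oo) (box_volume (a k) (b k))%:E].

Definition euclidean_dist (x y : E) : R :=
  Num.sqrt (\sum_(i < d) (x ord0 i - y ord0 i) ^+ 2)%R.

Definition ediameter (A : set E) : \bar R :=
  ereal_sup [set t | exists x y, [/\ A x, A y & t = (euclidean_dist x y)%:E]].

(* The power is 1 for m = 0, whence the separate treatment of set0. *)
Definition hausdorff_gauge (m : nat) (A : set E) : \bar R :=
  if A == set0 then 0 else ediameter A ^+ m.

Definition hausdorff_content (m : nat) (delta : R) (A : set E) : \bar R :=
  ereal_inf [set s | exists C : nat -> set E,
    [/\ A `<=` \bigcup_k C k,
        forall k, ediameter (C k) <= delta%:E
      & s = \sum_(0 <= k <oo) hausdorff_gauge m (C k)]].

(* m-dimensional Hausdorff (surface) measure, up to the usual positive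
   normalization constant, which affects neither |A| = 0 nor |A| > 0. *)
Definition hausdorff (m : nat) (A : set E) : \bar R :=
  ereal_sup [set hausdorff_content m delta A | delta in [set t : R | (0 < t)%R]].

End Measures.

Definition half_space (R : realType) (m : nat) : set 'rV[R]_m :=
  [set y | forall i : 'I_m, val i = 0%N -> 0 <= y ord0 i].

(* Omega is an m-dimensional topological manifold in R^d, possibly with
   boundary: it is covered by relatively open sets Omega `&` U homeomorphic,
   through f and g, to relatively open subsets W `&` half_space of the
   half-space. *)
Definition is_manifold (R : realType) (d m : nat) (Omega : set 'rV[R]_d) :=
  forall x, Omega x ->
  exists (U : set 'rV[R]_d) (W : set 'rV[R]_m)
         (f : 'rV[R]_d -> 'rV[R]_m) (g : 'rV[R]_m -> 'rV[R]_d),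
    let A := Omega `&` U in let B := W `&` @half_space R m in
    [/\ open U, U x & open W] /\
    [/\ f @` A `<=` B, g @` B `<=` A,
        forall y, A y -> g (f y) = y & forall z, B z -> f (g z) = z] /\
    {within A, continuous f} /\ {within B, continuous g}.

(* spatial_domain Omega vol: Omega is a bounded domain or a manifold in R^d,
   and vol is the measure |.| that goes with it. *)
Variant spatial_domain (R : realType) (d : nat) (Omega : set 'rV[R]_d) :
    (set 'rV[R]_d -> \bar R) -> Prop :=
  | BoundedDomain of open Omega & connected Omega & bounded_set Omega :
      spatial_domain Omega (@lebesgue_outer R d)
  | Manifold m of is_manifold m Omega :
      spatial_domain Omega (@hausdorff R d m).

Section Meshes.
Variables (R : realType) (d : nat).
Variables (Omega : set 'rV[R]_d) (vol : set 'rV[R]_d -> \bar R).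

Definition is_mesh (TH : {fset set 'rV[R]_d}) : Prop :=
  [/\ forall T, T \in TH -> compact T /\ (0 < vol T)%E,
      forall T T', T \in TH -> T' \in TH -> T <> T' -> vol (T `&` T') = 0%E
    & closure Omega = \bigcup_(T in [set` TH]) T].

Record mesh := Mesh { elements :> {fset set 'rV[R]_d}; _ : is_mesh elements }.

Definition refinement_strategy (refine : mesh -> {fset set 'rV[R]_d} -> mesh) :=
  forall (TH : mesh) (MH : {fset set 'rV[R]_d}), (MH `<=` TH)%fset ->
    (MH `<=` elements TH `\` elements (refine TH MH))%fset.

(* refinements refine TH is the set of meshes written T(TH) in the theory. *)
Inductive refinements (refine : mesh -> {fset set 'rV[R]_d} -> mesh)
    (TH : mesh) : set mesh :=
  | refinements_refl : refinements refine TH TH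
  | refinements_step Th Mh : refinements refine TH Th -> (Mh `<=` elements Th)%fset ->
      refinements refine TH (refine Th Mh).

(* Only the values eta TH T with T \in TH are meaningful. *)
Definition estimator (eta : mesh -> set 'rV[R]_d -> R) (TH : mesh)
    (UH : {fset set 'rV[R]_d}) : R :=
  Num.sqrt (\sum_(T <- UH) eta TH T ^+ 2).

Definition adaptive_output (refine : mesh -> {fset set 'rV[R]_d} -> mesh)
    (T0 : mesh) (Tl : nat -> mesh) (Ml : nat -> {fset set 'rV[R]_d}) :=
  Tl 0%N = T0 /\
  forall l, (Ml l `<=` elements (Tl l))%fset /\ Tl l.+1 = refine (Tl l) (Ml l).

End Meshes.

(* A function from R_{>=0} to R_{>=0}, given by its values on [0, +oo[, that is
   continuous at 0 relative to [0, +oo[ and vanishes at 0. *)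
Definition perturbation (R : realType) (S : R -> R) :=
  [/\ forall t, 0 <= t -> 0 <= S t,
      S t @[t --> within `[0, +oo[ (nbhs (0 : R))] --> S 0
    & S 0 = 0].

(* Main.v *)
(* Split eta_{l+1}^2 over T_{l+1} into non-refined and refined elements. By
   Young's inequality, stability and reduction bound it by
   (1 + delta) (eta_l^2 - b) + qred b + p_l, where b := eta_l(T_l \ T_{l+1})^2
   and p_l -> 0 since u_{l+1} - u_l -> 0. The marked elements are refined, so
   b >= theta eta_l^2, and delta := (1 - qred) theta / 2 gives
   eta_{l+1}^2 <= (1 - delta) eta_l^2 + p_l, which forces eta_l -> 0. *)
Require Import Defs.
From mathcomp Require Import ring lra.

Set Implicit Arguments.
Unset Strict Implicit.
Unset Printing Implicit Defensive.

(** The number [e / 2] is the fixed point of the map taking [x] to [k * x + (1 - k) * (e / 2)]. Once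
    [p] stays below [(1 - k) * (e / 2)], iteration therefore leaves an excess over [e / 2] that
    decays like [k ^+ m]. *)
Lemma cvg0_perturbed_contraction (R : realType) (k : R) (a p : nat -> R) :
  0 <= k < 1 -> (forall n, 0 <= a n) ->
  (forall n, a n.+1 <= k * a n + p n) ->
  p @ \oo --> (0 : R) -> a @ \oo --> (0 : R).
Proof.
move=> /andP[k0 k1] a0 ha hp; apply/cvgrPdist_le => e e0.
have k1' : 0 < 1 - k by lra.
have pe0 : 0 < (1 - k) * (e / 2) by rewrite mulr_gt0// divr_gt0.
move/cvgrPdist_le : hp => /(_ _ pe0)[N _ hN].
have step m : a (N + m)%N <= k ^+ m * a N + e / 2.
  elim: m => [|m ih]; first by rewrite addn0 expr0 mul1r; lra.
  rewrite addnS exprS -mulrA; apply: le_trans (ha _) _.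
  have pm : p (N + m)%N <= (1 - k) * (e / 2).
    have := hN (N + m)%N (leq_addr _ _).
    by rewrite /= sub0r normrN; apply: le_trans; exact: ler_norm.
  have := ler_wpM2l k0 ih; rewrite mulrDr; lra.
have /cvgrPdist_le/(_ _ (divr_gt0 e0 (ltr0n _ 2)))[M _ hM] :
    (fun m => k ^+ m * a N) @ \oo --> (0 : R).
  rewrite -[X in _ --> X](mul0r (a N)); apply: cvgM; last exact: cvg_cst.
  by apply: cvg_expr; rewrite ger0_norm.
exists (N + M)%N => //= n hn.
rewrite sub0r normrN ger0_norm//.
have Nn : (N <= n)%N by exact: leq_trans (leq_addr _ _) hn.
have hkm : k ^+ (n - N) * a N <= e / 2.
  have := hM (n - N)%N; rewrite /= leq_subRL// sub0r normrN => /(_ hn).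
  by apply: le_trans; exact: ler_norm.
by have := step (n - N)%N; rewrite subnKC//; lra.
Qed.

(** Continuity at 0 is only relative to [[0, +oo[]; the sign of [t] keeps the sequence where it
    applies. *)
Lemma perturbation_cvg0 (R : realType) (S : R -> R) (t : nat -> R) :
  perturbation S -> (forall n, 0 <= t n) -> t @ \oo --> (0 : R) ->
  (fun n => S (t n)) @ \oo --> (0 : R).
Proof.
move=> [_ cS S0] t0 ct; rewrite S0 in cS.
apply: (cvg_comp t S _ cS) => A /= hA; have := ct _ hA.
by rewrite /fmap /nbhs/=; apply: filterS => n /=; apply; rewrite /= in_itv/= t0.
Qed.

(** The right side minus the left side is [c^-1 * (c * x - y) ^+ 2]. *)
Lemma sqrrD_le_young (R : realFieldType) (c x y : R) : 0 < c ->
  (x + y) ^+ 2 <= (1 + c) * x ^+ 2 + (1 + c^-1) * y ^+ 2.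
Proof.
move=> c0; have cV : c * c^-1 = 1 by rewrite divff// gt_eqF.
have : 0 <= c^-1 * (c * x - y) ^+ 2.
  by rewrite mulr_ge0 ?sqr_ge0// invr_ge0 ltW.
have -> : c^-1 * (c * x - y) ^+ 2 =
    (c * c^-1) * c * x ^+ 2 - 2 * (c * c^-1) * (x * y) + c^-1 * y ^+ 2 by ring.
rewrite cV; nra.
Qed.

Section Estimator.
Variables (R : realType) (d : nat).
Variables (Omega : set 'rV[R]_d) (vol : set 'rV[R]_d -> \bar R).
Variables (eta : mesh Omega vol -> set 'rV[R]_d -> R) (TH : mesh Omega vol).
Implicit Types A B : {fset set 'rV[R]_d}.

Lemma estimator_ge0 A : 0 <= estimator eta TH A.
Proof. exact: sqrtr_ge0. Qed.

Lemma sqr_estimator A :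
  estimator eta TH A ^+ 2 = \sum_(T <- A) eta TH T ^+ 2.
Proof. by rewrite sqr_sqrtr// sumr_ge0// => T _; exact: sqr_ge0. Qed.

Lemma sqr_estimatorID B A : estimator eta TH A ^+ 2 =
  estimator eta TH (A `&` B)%fset ^+ 2 + estimator eta TH (A `\` B)%fset ^+ 2.
Proof.
rewrite !sqr_estimator (big_fsetID _ (mem B))/=; congr (_ + _).
  by apply: eq_fbigl => T; rewrite !inE.
by apply: eq_fbigl => T; rewrite !inE andbC.
Qed.

Lemma sqr_estimatorS A B : (A `<=` B)%fset ->
  estimator eta TH A ^+ 2 <= estimator eta TH B ^+ 2.
Proof.
move=> /fsetIidPr AB.
by rewrite (sqr_estimatorID A B) AB lerDl sqr_ge0.
Qed.

End Estimator.

Theorem theorem4 (R : realType) (d : nat) (hd : (0 < d)%N)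
  (Omega : set 'rV[R]_d) (vol : set 'rV[R]_d -> \bar R)
  (hOmega : spatial_domain Omega vol) (hvol : (0 < vol Omega)%E)
  (refine : mesh Omega vol -> {fset set 'rV[R]_d} -> mesh Omega vol)
  (hrefine : refinement_strategy refine)
  (T0 : mesh Omega vol)
  (X : normedModType R) (XH : mesh Omega vol -> submodClosed X)
  (u : mesh Omega vol -> X) (hu : forall TH, u TH \in XH TH)
  (eta : mesh Omega vol -> set 'rV[R]_d -> R)
  (heta : forall (TH : mesh Omega vol) (T : set 'rV[R]_d),
     T \in elements TH -> 0 <= eta TH T)
  (S Rf : R -> R) (hS : perturbation S) (hRf : perturbation Rf)
  (qred : R) (hqred : 0 < qred < 1)
  (stability : forall TH Th : mesh Omega vol,
     refinements refine T0 TH -> refinements refine TH Th ->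
     estimator eta Th (elements Th `&` elements TH)%fset
       <= estimator eta TH (elements Th `&` elements TH)%fset
          + S `|u Th - u TH|)
  (reduction : forall TH Th : mesh Omega vol,
     refinements refine T0 TH -> refinements refine TH Th ->
     estimator eta Th (elements Th `\` elements TH)%fset ^+ 2
       <= qred * estimator eta TH (elements TH `\` elements Th)%fset ^+ 2
          + Rf `|u Th - u TH|)
  (theta : R) (htheta : 0 < theta <= 1)
  (Tl : nat -> mesh Omega vol) (Ml : nat -> {fset set 'rV[R]_d})
  (hTl : adaptive_output refine T0 Tl Ml)
  (doerfler : forall l : nat,
     theta * estimator eta (Tl l) (Tl l) ^+ 2
       <= estimator eta (Tl l) (Ml l) ^+ 2)
  (hconv : exists uinf : X,
     (fun l : nat => `|uinf - u (Tl l)|) @ \oo --> (0 : R)) :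
  (fun l : nat => estimator eta (Tl l) (Tl l)) @ \oo --> (0 : R).
Proof.
have [hT0 hTS] := hTl; have [uinf hu_inf] := hconv.
have /andP[q0 q1] := hqred; have /andP[th0 th1] := htheta.
have reach l : refinements refine T0 (Tl l).
  elim: l => [|l ih]; first by rewrite hT0; exact: refinements_refl.
  by have [hM ->] := hTS l; exact: refinements_step.
have next l : refinements refine (Tl l) (Tl l.+1).
  have [hM ->] := hTS l.
  by apply: refinements_step => //; exact: refinements_refl.
pose t l := `|u (Tl l.+1) - u (Tl l)|.
have ct : t @ \oo --> (0 : R).
  (* This majorant of [t] comes from the triangle inequality through [uinf]. *)
  have hsum : (fun l => `|uinf - u (Tl l.+1)| + `|uinf - u (Tl l)|) @ \oo
      --> (0 : R).
    rewrite -[X in _ --> X](addr0 0); apply: cvgD => //.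
    by move: hu_inf; rewrite -(cvg_shiftS (fun l => `|uinf - u (Tl l)|)).
  apply: (squeeze_cvgr _ (cvg_cst 0) hsum); near=> l.
  rewrite normr_ge0/= (distrC uinf (u (Tl l.+1))).
  by apply: le_trans (ler_normD _ _); rewrite addrA subrK.
have t0 l : 0 <= t l by exact: normr_ge0.
(* Reduction and marking together gain [2 * c] times [E l]; Young's inequality with parameter [c]
   gives back half of it. *)
pose c := (1 - qred) * theta / 2.
have c0 : 0 < c by rewrite divr_gt0// mulr_gt0//; lra.
have c1 : c < 1 by rewrite /c; nra.
(* [S] is squared and weighted by Young's factor because stability is stated for unsquared
   estimators, whereas reduction already concerns squares. *)
pose p l := (1 + c^-1) * S (t l) ^+ 2 + Rf (t l).
have cp : p @ \oo --> (0 : R).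
  have cS := perturbation_cvg0 hS t0 ct.
  have -> : (0 : R) = (1 + c^-1) * (0 * 0) + 0 by rewrite mulr0 mulr0 addr0.
  apply: cvgD; last exact: perturbation_cvg0.
  by apply: cvgM; [exact: cvg_cst|exact: cvgM].
pose E l := estimator eta (Tl l) (Tl l) ^+ 2.
have contraction l : E l.+1 <= (1 - c) * E l + p l.
  have refined : theta * E l <=
      estimator eta (Tl l) (elements (Tl l) `\` elements (Tl l.+1))%fset ^+ 2.
    apply: le_trans (doerfler l) _; apply: sqr_estimatorS.
    by have [hM ->] := hTS l; exact: hrefine.
  have := reduction _ _ (reach l) (next l).
  have := stability _ _ (reach l) (next l); rewrite -/(t l).
  rewrite -(@ler_pXn2r _ 2)// ?nnegrE ?addr_ge0 ?estimator_ge0//; last first.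
    by have [+ _ _] := hS; apply.
  move=> /le_trans/(_ (sqrrD_le_young _ _ c0)).
  (* Each of the two meshes is split by the other; [fsetIC] then gives both splittings the same
     common part, the one in [stability]. *)
  have := sqr_estimatorID eta (Tl l) (Tl l.+1) (Tl l).
  have := sqr_estimatorID eta (Tl l.+1) (Tl l) (Tl l.+1).
  rewrite -/(E l) -/(E l.+1) /p [(Tl l `&` _)%fset]fsetIC => -> EI.
  move: EI refined; set b := estimator _ _ (_ `\` _)%fset ^+ 2.
  have b0 : 0 <= b by exact: sqr_ge0.
  move=> EI refined stab red.
  have hb : (1 - qred) * (theta * E l) <= (1 - qred) * b.
    by rewrite ler_wpM2l//; lra.
  have cE : c * E l *+ 2 = (1 - qred) * (theta * E l).
    by rewrite /c -mulr_natl; field.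
  have cb : 0 <= c * b by rewrite mulr_ge0// ltW.
  (* Up to [p l], the bound is [(1 + c) * (E l - b) + qred * b]. Dropping [- c * b] leaves
     [(1 + c) * E l - (1 - qred) * b], which by [hb] and [cE] is at most
     [(1 + c) * E l - 2 * c * E l]. *)
  nra.
have cE : E @ \oo --> (0 : R).
  apply: (@cvg0_perturbed_contraction _ (1 - c) _ p) => //.
    by lra.
  by move=> n; exact: sqr_ge0.
(* Writing the limit as the root of 0 lets continuity of the square root carry the convergence from
   [E] to the estimator. *)
rewrite -[X in _ --> X]sqrtr0.
have -> : (fun l => estimator eta (Tl l) (Tl l)) = (fun l => Num.sqrt (E l)).
  by apply/funext => l; rewrite sqrtr_sqr ger0_norm// estimator_ge0.
by apply: cvg_comp cE _; exact: sqrt_continuous.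
Unshelve. all: by end_near.
Qed.
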